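(* Let $r>0$, $0\le R<\infty$, $\varkappa=R/r$, and let $P$ be a random point uniformly distributed over the area of the disk $D_R$. Let $U_\varkappa$ be the perimeter of the ellipse generated by $P$ under the elliptic motion, and let $G_\varkappa(u)=\mathbb{P}[U_\varkappa\le u]$, $u\in\mathbb{R}$, be its distribution function. Then $$ G_\varkappa(u)= \begin{cases} 0 & \text{if } -\infty<u<2\pi r,\\[2pt] \dfrac{w^2(u)}{\varkappa^2} & \text{if } 2\pi r\le u<r\,h(\varkappa),\\[6pt] 1 & \text{if } r\,h(\varkappa)\le u<\infty, \end{cases} $$ where $w=w(u)\ge 0$ is the solution of $r\,h(w)=u$ and $$h(w)=4(w+1)\,E\!\left(\frac{2\sqrt{w}}{w+1}\right),\qquad w\ge 0 .$$
   Context: Elliptic motion: a circle of radius $r$ with centre $\varOmega$, attached to a moving plane $\varSigma$ with Cartesian coordinates $(\xi,\eta)$ and origin $\varOmega$, rolls inside a fixed circle of radius $2r$ centred at the origin $O$ of a fixed plane. A point $P=(\xi,\eta)\in\varSigma$ generates in the fixed plane (identified with $\mathbb{C}$) the closed curve $$X(\varphi)=r\,\mathrm{e}^{\mathrm{i}\varphi}+(\xi+\mathrm{i}\eta)\,\mathrm{e}^{-\mathrm{i}\varphi},\qquad 0\le\varphi<2\pi .$$ With $\varrho=\sqrt{\xi^2+\eta^2}$ this is an ellipse with semi-axes $r+\varrho$ and $|r-\varrho|$ (degenerating to a doubly traversed line segment of length $4r$ if $\varrho=r$). ''The ellipse generated by $P$'' means this curve, and its perimeter is the length of the curve over one period $0\le\varphi<2\pi$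 (so it is $8r$ in the degenerate case). The disk is $D_R=\{(\xi,\eta)\in\varSigma: 0\le\xi^2+\eta^2\le R^2\}$. For $R=0$ the disk is the single point $\varOmega$ and $P=\varOmega$ (then the middle range of $u$ is empty, since $h(0)=2\pi$). The complete elliptic integral of the second kind with modulus $k$ (not parameter $k^2$), $0\le k\le 1$, is $E(k)=\int_0^{\pi/2}\sqrt{1-k^2\sin^2\theta}\;\mathrm{d}\theta$. *)

(* Defs.v *)
From mathcomp Require Import all_boot all_order all_algebra.
From mathcomp Require Import complex.
From mathcomp Require Import all_classical all_reals all_analysis.

Set Implicit Arguments.
Unset Strict Implicit.
Unset Printing Implicit Defensive.

Import Order.TTheory GRing.Theory Num.Theory.
Import numFieldNormedType.Exports.

Local Open Scope classical_set_scope.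
Local Open Scope ring_scope.
Local Open Scope complex_scope.

Definition cis (R : realType) (t : R) : R[i] := cos t +i* sin t.

(* The path of the point p = (xi, eta) of the moving plane, for a rolling
   circle of radius r. *)
Definition elliptic_motion (R : realType) (r : R) (p : R * R) (phi : R) : R[i] :=
  r%:C * cis phi + (p.1 +i* p.2) * cis (- phi).

(* Arc length of a continuously differentiable plane curve: the integral of the
   modulus of its velocity, whose components are the derivatives of the real
   and imaginary parts. *)
Definition curve_length (R : realType) (gamma : R -> R[i]) (a b : R) : R :=
  \int[@lebesgue_measure R]_(t in `[a, b])
    Num.sqrt (derive1 (fun s => complex.Re (gamma s)) t ^+ 2 +
              derive1 (fun s => complex.Im (gamma s)) t ^+ 2).

Definition perimeter (R : realType) (r : R) (p : R * R) : R :=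
  curve_length (elliptic_motion r p) 0 (2 * pi).

(* The argument k is the modulus, not the parameter k ^+ 2. *)
Definition ellipticE (R : realType) (k : R) : R :=
  \int[@lebesgue_measure R]_(t in `[0, pi / 2])
    Num.sqrt (1 - k ^+ 2 * sin t ^+ 2).

Definition h (R : realType) (w : R) : R :=
  4 * (w + 1) * ellipticE (2 * Num.sqrt w / (w + 1)).

Definition disk (R : realType) (rad : R) : set (R * R) :=
  [set p | p.1 ^+ 2 + p.2 ^+ 2 <= rad ^+ 2].

(* Normalized area on the disk; for rad = 0 the disk is a single point of area
   zero and the distribution is the point mass there. *)
Definition uniform_disk (R : realType) (rad : R) (A : set (R * R)) : \bar R :=
  let area := (@lebesgue_measure R \x @lebesgue_measure R)%E in
  if rad == 0 then @dirac _ (R * R)%type (0, 0) R A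
  else (area (A `&` disk rad) / area (disk rad))%E.

(* Main.v *)
Require Import Defs.
From mathcomp Require Import all_boot all_order all_algebra.
From mathcomp Require Import complex.
From mathcomp Require Import all_classical all_reals all_analysis.
From mathcomp Require Import measurable_realfun ring lra.

Set Implicit Arguments.
Unset Strict Implicit.
Unset Printing Implicit Defensive.

Import Order.TTheory GRing.Theory Num.Theory.
Import numFieldNormedType.Exports.

Local Open Scope classical_set_scope.
Local Open Scope ring_scope.

(** The perimeter is a strictly increasing function of the distance from the
    point to the centre of the moving plane, so its sublevel sets are
    concentric disks and its distribution function is a ratio of areas.

    The velocity of the curve generated by p = (xi, eta) has modulus
    |r - (xi + i eta) e^(-2 i phi)|. Write rho for the modulus of p and
    w = rho / r. After a translation of phi this velocity becomes
    r |1 + w e^(2 i phi)|, a pi-periodic function of phi whose four quarter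
    periods in [0, 2 pi] contribute equally ([perimeterE]). The identity
    |1 + w e^(2 i t)|^2 = (1 + w)^2 - 4 w sin^2 t identifies the integral over
    a quarter period with the elliptic integral in h ([hE]), so the perimeter
    is r h(w).

    Monotonicity of h needs no derivative of E: w |-> |1 + w e^(2 i t)| is
    convex, strictly so for 0 < t < pi / 2, and its integral over [0, pi / 2]
    is even in w, because w |-> -w amounts to t |-> pi / 2 - t. A strictly
    convex even function increases strictly on [0, +oo[ ([quarter_length_lt]).
    The integrand is 1-Lipschitz in w, so h is continuous, and the intermediate
    value theorem solves r h(w) = u.

    Only ratios of areas of disks matter. Slicing a disk into chords and
    rescaling the slicing variable shows that its area is s^2 times a positive
    constant ([area_disk]); the value of the constant cancels. *)

(** * Integrals of continuous functions over segments *)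

Section continuous_integrals.
Context {R : realType}.
Notation mu := (@lebesgue_measure R).
Implicit Types (g : R -> R) (a b c : R).

Lemma continuous_integrable g a b : continuous g ->
  mu.-integrable `[a, b] (EFin \o g).
Proof.
move=> cg; apply: continuous_compact_integrable; first exact: segment_compact.
exact: continuous_subspaceT.
Qed.

Lemma Rintegral_affine g a b c k : continuous g -> 0 < k -> a <= b ->
  \int[mu]_(x in `[k * a + c, k * b + c]) g x =
  k * \int[mu]_(x in `[a, b]) g (k * x + c).
Proof.
move=> cg k0 ab.
have cF : continuous (fun x : R => k * x + c).
  move=> x; apply: cvgD; last exact: cvg_cst.
  by apply: cvgM; [exact: cvg_cst|exact: cvg_id].
have dF (x : R) : is_derive x 1 (fun x : R => k * x + c : R) k.
  have := is_deriveD (is_deriveZ k (is_derive_id x (1 : R)))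
    (is_derive_cst c x (1 : R)).
  by rewrite addr0 [X in is_derive _ _ _ X]mulr1.
have DF : derive1 (fun x : R => k * x + c) = cst k.
  by apply/funext => x; rewrite derive1E derive_val.
rewrite -RintegralZl//; last first.
  apply: continuous_integrable => x.
  exact: (continuous_comp (cF x) (cg _)).
rewrite /Rintegral; congr fine.
rewrite (@integration_by_substitution_increasing _
  (fun x : R => k * x + c) g a b) //.
- by apply: eq_integral => x _; rewrite DF /= mulrC.
- by move=> x y _ _ xy; rewrite ltrD2r ltr_pM2l.
- by move=> x _; rewrite DF; exact: cvg_cst.
- by rewrite DF; exact: is_cvg_cst.
- by rewrite DF; exact: is_cvg_cst.
- split => [x _||].
  + by [].
  + by apply: cvg_at_right_filter; exact: cF.
  + by apply: cvg_at_left_filter; exact: cF.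
- exact: continuous_subspaceT.
Qed.

Lemma Rintegral_shift g a b c : continuous g -> a <= b ->
  \int[mu]_(x in `[a + c, b + c]) g x = \int[mu]_(x in `[a, b]) g (x + c).
Proof.
move=> cg ab; have := Rintegral_affine c cg ltr01 ab.
rewrite !mul1r => ->.
by apply: eq_Rintegral => x _; rewrite mul1r.
Qed.

Lemma Rintegral_reflect g c : continuous g -> 0 <= c ->
  \int[mu]_(x in `[0, c]) g (c - x) = \int[mu]_(x in `[0, c]) g x.
Proof.
move=> cg c0.
have cG : continuous (g \o -%R).
  by move=> x; apply: continuous_comp; [exact: oppr_continuous|exact: cg].
have := @integration_by_substitution_oppr R (g \o -%R) (- c) 0.
rewrite oppr0 opprK oppr_le0 => /(_ c0 (continuous_subspaceT cG)) e.
transitivity (\int[mu]_(x in `[0, c]) (g \o -%R) (x + (- c))).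
  by apply: eq_Rintegral => x _ /=; rewrite opprD opprK addrC.
rewrite -(Rintegral_shift (- c) cG c0) add0r subrr.
have := @integration_by_substitution_oppr R g (- c) 0.
rewrite oppr0 opprK oppr_le0 => /(_ c0 (continuous_subspaceT cg)) e'.
by rewrite /Rintegral e'.
Qed.

Lemma Rintegral_split g a b c : continuous g -> a <= b -> b <= c ->
  \int[mu]_(x in `[a, c]) g x =
  \int[mu]_(x in `[a, b]) g x + \int[mu]_(x in `[b, c]) g x.
Proof.
move=> cg ab bc.
have ig := @continuous_integrable g a c cg.
rewrite -(@Rintegral_itv_obnd_cbnd _ b); last first.
  by apply: integrableS ig => //; apply: subset_itvr; rewrite bnd_simp.
rewrite -(@Rintegral_itvB _ g (BLeft a) (BRight c) b) ?bnd_simp//.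
by rewrite addrC subrK.
Qed.

(** The part of the shifted segment beyond [T], translated back by the period,
    fills the missing part from 0 to [a]. *)
Lemma Rintegral_periodic g T a : continuous g -> (forall x, g (x + T) = g x) ->
  0 <= a <= T ->
  \int[mu]_(x in `[0, T]) g (x + a) = \int[mu]_(x in `[0, T]) g x.
Proof.
move=> cg gT /andP[a0 aT].
have T0 := le_trans a0 aT.
rewrite -Rintegral_shift// add0r (@Rintegral_split _ _ T)//;
  last by rewrite lerDl.
rewrite (@Rintegral_split _ 0 a T)// addrC; congr (_ + _).
rewrite -{1}[T]add0r (addrC T) Rintegral_shift//.
by apply: eq_Rintegral => x _; rewrite gT.
Qed.

(** A nonnegative integrand with zero integral vanishes almost everywhere,
    whereas a nonempty open interval has positive length. *)
Lemma Rintegral_gt0 g a b : continuous g -> a < b ->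
  (forall x, a < x < b -> 0 < g x) -> 0 < \int[mu]_(x in `[a, b]) g x.
Proof.
move=> cg ab gp.
have ig : mu.-integrable `]a, b[ (EFin \o g).
  apply: integrableS (@continuous_integrable g a b cg) => //.
  exact: subset_itv_oo_cc.
have {}gp x : x \in `]a, b[ -> 0 < g x by rewrite in_itv; exact: gp.
have -> : \int[mu]_(x in `[a, b]) g x = \int[mu]_(x in `]a, b[) g x.
  rewrite Rintegral_itv_bndo_bndc// Rintegral_itv_obnd_cbnd//.
  apply: integrableS (@continuous_integrable g a b cg) => //.
  by apply: subset_itvr; rewrite bnd_simp.
have I0 : 0 <= \int[mu]_(x in `]a, b[) g x.
  by apply: Rintegral_ge0 => x /gp/ltW.
rewrite lt_neqAle I0 andbT; apply/eqP => /esym I.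
have /(ae_eq_integral_abs mu) : (measurable (`]a, b[ : set R)) by [].
move=> /(_ (EFin \o g)) [].
  exact: (measurable_int mu).
move=> H _; have /H [N [mN N0 sN]] :
    (\int[mu]_(x in `]a, b[) `|(EFin \o g) x| = 0)%E.
  transitivity (\int[mu]_(x in `]a, b[) (g x)%:E)%E.
    apply: eq_integral => x; rewrite inE => /gp/ltW gx.
    by rewrite /= ger0_norm.
  rewrite -[LHS]fineK; last exact: integrable_fin_num.
  by move: I; rewrite /Rintegral => ->.
have /(le_measure mu) : `]a, b[ `<=` N.
  move=> x xab; apply: sN => /= gx0; have := gp _ xab.
  by have [->] := gx0 xab; rewrite ltxx.
rewrite !inE => /(_ (measurable_itv _) mN).
rewrite [X in (_ <= X)%E]N0 [X in (X <= _)%E]lebesgue_measure_itv /=.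
by rewrite lte_fin ab -EFinD lee_fin subr_le0 leNgt ab.
Qed.

End continuous_integrals.

(** * The normalized velocity *)

(** This is |1 + w e^(2 i t)|, the modulus of the velocity for a rolling circle
    of radius 1 and a suitable origin of time. *)
Definition speed (R : realType) (w t : R) : R :=
  Num.sqrt (1 + w ^+ 2 + 2 * w * cos (t *+ 2)).

Section speed.
Context {R : realType}.
Implicit Types w a b t : R.

Lemma speed_ge0 w t : 0 <= speed w t.
Proof. exact: sqrtr_ge0. Qed.

Lemma sqr_speed w t : speed w t ^+ 2 = 1 + w ^+ 2 + 2 * w * cos (t *+ 2).
Proof.
rewrite sqr_sqrtr// -[X in X + _ + _](cos2Dsin2 (t *+ 2)).
set c := cos _; set s := sin _.
have -> : c ^+ 2 + s ^+ 2 + w ^+ 2 + 2 * w * c = (w + c) ^+ 2 + s ^+ 2 by ring.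
by rewrite addr_ge0 ?sqr_ge0.
Qed.

Lemma speedN w t : speed (- w) t = speed w (pi / 2 - t).
Proof.
rewrite /speed; congr Num.sqrt.
have -> : (pi / 2 - t) *+ 2 = - (t *+ 2) + pi :> R by lra.
by rewrite cosDpi cosN sqrrN; ring.
Qed.

Lemma speedDpi w t : speed w (t + pi) = speed w t.
Proof. by rewrite /speed mulrnDl cosD2pi. Qed.

Lemma speed_reflect w t : speed w (pi - t) = speed w t.
Proof. by rewrite /speed mulrnBl [pi *+ 2 - _]addrC cosD2pi cosN. Qed.

Lemma continuous_speed w : continuous (speed w).
Proof.
move=> t; apply: continuous_comp; last exact: sqrt_continuous.
apply: cvgD; first exact: cvg_cst.
apply: cvgM; first exact: cvg_cst.
apply: (@continuous_comp _ _ _ (fun t : R => t *+ 2) cos).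
  exact: natmul_continuous.
exact: continuous_cos.
Qed.

(** The reverse triangle inequality for the points 1 + a e^(2 i t) and
    1 + b e^(2 i t). Squared, it is the Cauchy-Schwarz inequality for these two
    vectors, whose scalar product is [1 + a * b + (a + b) * c] and whose
    determinant is [(b - a) * s], with [c] and [s] the cosine and sine of 2 t. *)
Lemma speed_lipschitz a b t : speed a t - speed b t <= `|a - b|.
Proof.
have [|ab] := leP (speed a t) (speed b t).
  by rewrite -subr_le0 => /le_trans; apply.
rewrite -(@ler_pXn2r _ 2) ?nnegrE ?subr_ge0 ?(ltW ab)// real_normK ?num_real//.
have A0 := speed_ge0 a t; have B0 := speed_ge0 b t.
have A2 := sqr_speed a t; have B2 := sqr_speed b t.
have cs := esym (sin2cos2 (t *+ 2)).
set c := cos _ in A2 B2 cs; set s := sin _ in cs.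
set A := speed a t in A0 A2 ab *; set B := speed b t in B0 B2 ab *.
suff : 1 + a * b + (a + b) * c <= A * B.
  by rewrite sqrrB A2 B2 => ?; rewrite sqrrB; lra.
apply: le_trans (ler_norm _) _.
rewrite -(@ler_pXn2r _ 2) ?nnegrE ?mulr_ge0// real_normK ?num_real//.
rewrite exprMn A2 B2.
have -> : (1 + a ^+ 2 + 2 * a * c) * (1 + b ^+ 2 + 2 * b * c) =
  (1 + a * b + (a + b) * c) ^+ 2 + (a - b) ^+ 2 * (1 - c ^+ 2) by ring.
by rewrite lerDl cs mulr_ge0 ?sqr_ge0.
Qed.

(** Strict convexity in [w]: [a] is the barycentre of [b] and
    [- b] with weights [(b + a) / (2 * b)] and [(b - a) / (2 * b)]. It is strict
    as 1 + b e^(2 i t) and 1 - b e^(2 i t) are not positively parallel. *)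
Lemma speed_chord_lt a b t : 0 <= a < b -> 0 < t < pi / 2 ->
  2 * b * speed a t < (b + a) * speed b t + (b - a) * speed (- b) t.
Proof.
move=> /andP[a0 ab] /andP[t0 tpi].
have s0 : 0 < sin (t *+ 2) by rewrite sin_gt0_pi//; lra.
have A0 := speed_ge0 b t; have B0 := speed_ge0 (- b) t.
have C0 := speed_ge0 a t.
have A2 := sqr_speed b t; have B2 := sqr_speed (- b) t.
have C2 := sqr_speed a t.
have cs := esym (sin2cos2 (t *+ 2)).
set c := cos _ in A2 B2 C2 cs; set s := sin _ in s0 cs.
set A := speed b t in A0 A2 *; set B := speed (- b) t in B0 B2 *.
set C := speed a t in C0 C2 *.
(* Cauchy-Schwarz: 1 - b^2 is the scalar product of 1 + b e^(2 i t) and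
   1 - b e^(2 i t), and their determinant does not vanish. *)
have AB : 1 - b ^+ 2 < A * B.
  apply: le_lt_trans (ler_norm _) _.
  rewrite -(@ltr_pXn2r _ 2) ?nnegrE ?mulr_ge0// real_normK ?num_real//.
  rewrite exprMn A2 B2 -subr_gt0.
  set rhs := (X in 0 < X).
  have -> : rhs = 4 * b ^+ 2 * (1 - c ^+ 2) by rewrite /rhs; ring.
  by rewrite cs !mulr_gt0 ?exprn_gt0//; lra.
rewrite -(@ltr_pXn2r _ 2) ?nnegrE//; last 2 first.
- by rewrite !mulr_ge0//; lra.
- by rewrite addr_ge0// mulr_ge0//; lra.
rewrite -subr_gt0.
have -> : ((b + a) * A + (b - a) * B) ^+ 2 - (2 * b * C) ^+ 2 =
  (b + a) ^+ 2 * A ^+ 2 + (b - a) ^+ 2 * B ^+ 2 - 4 * b ^+ 2 * C ^+ 2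
  + 2 * (b ^+ 2 - a ^+ 2) * (A * B) by ring.
rewrite A2 B2 C2.
set rhs := (X in 0 < X).
have -> : rhs = 2 * ((b - a) * (b + a)) * (A * B - (1 - b ^+ 2)).
  by rewrite /rhs; ring.
by rewrite !mulr_gt0//; lra.
Qed.

End speed.

(** * The function h *)

Definition quarter_length (R : realType) (w : R) : R :=
  \int[@lebesgue_measure R]_(t in `[0, pi / 2]) speed w t.

Section quarter.
Context {R : realType}.
Notation mu := (@lebesgue_measure R).
Implicit Types w a b t : R.

(** Since cos (2 t) = 1 - 2 sin^2 t, the radicand of [speed w t] is
    (w + 1)^2 - 4 w sin^2 t. *)
Lemma hE w : 0 <= w -> h w = 4 * quarter_length w.
Proof.
move=> w0; have w1 : 0 < w + 1 by lra.
rewrite /h /ellipticE -mulrA; congr (_ * _).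
rewrite -RintegralZl//; last first.
  apply: continuous_integrable => t.
  apply: continuous_comp; last exact: sqrt_continuous.
  apply: cvgB; first exact: cvg_cst.
  apply: cvgM; first exact: cvg_cst.
  by apply: cvgM; exact: continuous_sin.
apply: eq_Rintegral => t _.
rewrite -{1}(ger0_norm (ltW w1)) -sqrtr_sqr -sqrtrM ?sqr_ge0//.
rewrite /speed cos_mulr2n cos2sin2; congr Num.sqrt.
rewrite !exprMn sqr_sqrtr// exprVn.
by field; rewrite gt_eqF.
Qed.

Lemma quarter_lengthN w : quarter_length (- w) = quarter_length w.
Proof.
rewrite /quarter_length; under eq_Rintegral do rewrite speedN.
by apply: Rintegral_reflect; [exact: continuous_speed|rewrite divr_ge0 ?pi_ge0].
Qed.

(** The integral of the strict convexity inequality is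
    2 b J(a) < (b + a) J(b) + (b - a) J(- b), where J is the quarter length;
    by evenness the right-hand side is 2 b J(b). *)
Lemma quarter_length_lt a b : 0 <= a < b -> quarter_length a < quarter_length b.
Proof.
move=> ab; have b0 : 0 < b by case/andP: ab; exact: le_lt_trans.
have i w k : mu.-integrable `[0, pi / 2] (EFin \o (fun t => k * speed w t)).
  by apply: continuous_integrable => t; apply: cvgM;
    [exact: cvg_cst|exact: continuous_speed].
have i' w : mu.-integrable `[0, pi / 2] (EFin \o (speed w)).
  by apply: continuous_integrable; exact: continuous_speed.
have : 0 < \int[mu]_(t in `[0, pi / 2])
    ((b + a) * speed b t + (b - a) * speed (- b) t - 2 * b * speed a t).
  apply: Rintegral_gt0.
  - move=> t; apply: cvgB; last first.
      by apply: cvgM; [exact: cvg_cst|exact: continuous_speed].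
    by apply: cvgD; apply: cvgM; (exact: cvg_cst || exact: continuous_speed).
  - by rewrite divr_gt0 ?pi_gt0.
  - by move=> t t01; rewrite subr_gt0 speed_chord_lt.
rewrite RintegralB//; last first.
  apply: continuous_integrable => t.
  by apply: cvgD; apply: cvgM; (exact: cvg_cst || exact: continuous_speed).
rewrite RintegralD// !RintegralZl// -!/(quarter_length _) quarter_lengthN => ?.
rewrite -(@ltr_pM2l _ (2 * b)); lra.
Qed.

Lemma quarter_length_lipschitz a b :
  quarter_length a - quarter_length b <= pi / 2 * `|a - b|.
Proof.
have i' w : mu.-integrable `[0, pi / 2] (EFin \o (speed w)).
  by apply: continuous_integrable; exact: continuous_speed.
rewrite /quarter_length -RintegralB//.
apply: (@le_trans _ _ (\int[mu]_(t in `[0, pi / 2]) `|a - b|)).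
  apply: le_Rintegral => //.
  - apply: continuous_integrable => t.
    by apply: cvgB; exact: continuous_speed.
  - by apply: continuous_integrable => t; exact: cvg_cst.
  - by move=> t _; exact: speed_lipschitz.
rewrite Rintegral_cst// [X in fine X]lebesgue_measure_itv /=
  lte_fin divr_gt0 ?pi_gt0//.
by rewrite -EFinD /= subr0 mulrC.
Qed.

Lemma quarter_length_continuous : continuous (@quarter_length R).
Proof.
move=> a; apply/cvgrPdist_le => /= e e0.
have p0 : 0 < pi / 2 :> R by rewrite divr_gt0 ?pi_gt0.
near=> b.
have ab : `|a - b| <= e / (pi / 2).
  by near: b; apply: cvgr_dist_le; [exact: cvg_id|rewrite divr_gt0].
rewrite ler_pdivlMr// mulrC in ab.
rewrite ler_norml; apply/andP; split.
  rewrite lerNl opprB; apply: le_trans ab.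
  by rewrite (distrC a); exact: quarter_length_lipschitz.
by apply: le_trans ab; exact: quarter_length_lipschitz.
Unshelve. all: by end_near. Qed.

Lemma h0E : h 0 = 2 * pi :> R.
Proof.
rewrite hE// /quarter_length.
under eq_Rintegral do
  rewrite /speed expr0n /= mulr0 mul0r !addr0 sqrtr1.
rewrite Rintegral_cst// [X in fine X]lebesgue_measure_itv /=
  lte_fin divr_gt0 ?pi_gt0//=.
by rewrite mul1r subr0; field.
Qed.

Lemma h_lt a b : 0 <= a < b -> h a < h b.
Proof.
move=> /andP[a0 ab]; rewrite !hE ?(le_trans a0 (ltW ab))// ltr_pM2l//.
by rewrite quarter_length_lt// a0.
Qed.

Lemma h_le_mono a b : 0 <= a -> 0 <= b -> (h a <= h b) = (a <= b).
Proof.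
move=> a0 b0; have [|ba] := leP a b.
  by rewrite le_eqVlt => /predU1P[->|ab]; rewrite ?lexx// ltW// h_lt// a0.
by apply/negbTE; rewrite -ltNge h_lt// b0.
Qed.

Lemma h_IVT a b v : 0 <= a <= b -> h a <= v <= h b ->
  exists2 w, a <= w <= b & h w = v.
Proof.
move=> /andP[a0 ab] /andP[av vb]; have b0 := le_trans a0 ab.
have hab := le_trans av vb.
have [||w wab wv] := @IVT R (fun w => 4 * quarter_length w) a b v ab.
- apply: continuous_subspaceT => x.
  by apply: cvgM; [exact: cvg_cst|exact: quarter_length_continuous].
- by rewrite -!hE// (min_idPl hab) (max_idPr hab) av.
exists w; first by move: wab; rewrite in_itv.
by rewrite hE//; move: wab; rewrite in_itv => /andP[/(le_trans a0)].
Qed.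

End quarter.

(** * The perimeter of the generated ellipse *)

Section perimeter.
Context {R : realType}.
Notation mu := (@lebesgue_measure R).
Implicit Types (r w x y t : R) (p : R * R).

(** The angle is written [a *+ 2] because the velocity depends on twice the
    time. *)
Lemma polar_coordinates x y : exists2 a : R, 0 <= a <= pi &
  x = Num.sqrt (x ^+ 2 + y ^+ 2) * cos (a *+ 2) /\
  y = Num.sqrt (x ^+ 2 + y ^+ 2) * sin (a *+ 2).
Proof.
set d := Num.sqrt _.
have d2 : d ^+ 2 = x ^+ 2 + y ^+ 2 by rewrite sqr_sqrtr// addr_ge0 ?sqr_ge0.
have [d0|d0] := eqVneq d 0.
  exists 0; first by rewrite lexx pi_ge0.
  have := sqr_ge0 x; have := sqr_ge0 y.
  move: d2; rewrite d0 !mul0r expr0n /= => e y2 x2.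
  by split; apply/eqP; rewrite -sqrf_eq0 eq_le ?x2 ?y2 andbT; lra.
have {}d0 : 0 < d by rewrite lt_neqAle eq_sym d0 sqrtr_ge0.
have xd : -1 <= x / d <= 1.
  rewrite ler_pdivlMr// ler_pdivrMr// mulN1r mul1r -ler_norml.
  rewrite -(@ler_pXn2r _ 2) ?nnegrE ?(ltW d0)// real_normK ?num_real//.
  by rewrite d2 lerDl sqr_ge0.
have [/andP[c0 cpi] cosc] := acos_def xd.
have dsin : d * sin (acos (x / d)) = `|y|.
  rewrite sin_acos// -{1}(ger0_norm (ltW d0)) -sqrtr_sqr -sqrtrM ?sqr_ge0//.
  rewrite -[RHS]sqrtr_sqr; congr Num.sqrt.
  have -> : y ^+ 2 = d ^+ 2 - x ^+ 2 by rewrite d2; ring.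
  by field; rewrite gt_eqF.
have dcos : d * cos (acos (x / d)) = x by rewrite cosc mulrC divfK ?gt_eqF.
have [y0|y0] := leP 0 y.
  exists (acos (x / d) / 2); first by lra.
  have -> : (acos (x / d) / 2) *+ 2 = acos (x / d) by lra.
  by rewrite dcos dsin ger0_norm.
exists (pi - acos (x / d) / 2); first by lra.
have -> : (pi - acos (x / d) / 2) *+ 2 = - acos (x / d) + pi *+ 2 by lra.
by rewrite cosD2pi sinD2pi cosN sinN mulrN dcos dsin ltr0_norm// opprK.
Qed.

Lemma speed_quarters w :
  \int[mu]_(t in `[0, 2 * pi]) speed w t = 4 * quarter_length w.
Proof.
rewrite /quarter_length.
have pi0 := @pi_ge0 R; have cs := @continuous_speed R w.
rewrite (@Rintegral_split _ _ _ pi)//; last by lra.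
have -> : \int[mu]_(t in `[pi, 2 * pi]) speed w t =
    \int[mu]_(t in `[0, pi]) speed w t.
  have -> : 2 * pi = pi + pi :> R by lra.
  rewrite -{1}[pi]add0r Rintegral_shift//.
  by apply: eq_Rintegral => t _; rewrite speedDpi.
rewrite (@Rintegral_split _ _ _ (pi / 2) pi)//; [|by lra..].
suff -> : \int[mu]_(t in `[pi / 2, pi]) speed w t =
    \int[mu]_(t in `[0, pi / 2]) speed w t by ring.
have -> : `[pi / 2, pi] = `[0 + pi / 2, pi / 2 + pi / 2] :> interval R.
  by congr (Interval (BLeft _) (BRight _)); lra.
rewrite Rintegral_shift//; last by lra.
rewrite -[RHS]Rintegral_reflect//; last by lra.
apply: eq_Rintegral => t _; rewrite -speed_reflect; congr speed; lra.
Qed.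

Lemma elliptic_motion_velocity r p t :
  derive1 (fun s => complex.Re (elliptic_motion r p s)) t ^+ 2 +
  derive1 (fun s => complex.Im (elliptic_motion r p s)) t ^+ 2 =
  r ^+ 2 + p.1 ^+ 2 + p.2 ^+ 2
  - 2 * r * (p.1 * cos (t *+ 2) + p.2 * sin (t *+ 2)).
Proof.
have -> : (fun s => complex.Re (elliptic_motion r p s)) =
    (r + p.1) *: @cos R + p.2 *: @sin R.
  apply/funext => s; rewrite /elliptic_motion /cis /= cosN sinN !fctE.
  by rewrite /GRing.scale /=; ring.
have -> : (fun s => complex.Im (elliptic_motion r p s)) =
    (r - p.1) *: @sin R + p.2 *: @cos R.
  apply/funext => s; rewrite /elliptic_motion /cis /= cosN sinN !fctE.
  by rewrite /GRing.scale /=; ring.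
rewrite !derive1E.
have /@derive_val -> := is_deriveD (is_deriveZ (r + p.1) (is_derive_cos t))
  (is_deriveZ p.2 (is_derive_sin t)).
have /@derive_val -> := is_deriveD (is_deriveZ (r - p.1) (is_derive_sin t))
  (is_deriveZ p.2 (is_derive_cos t)).
rewrite /GRing.scale /= cos_mulr2n sin_mulr2n.
have := cos2Dsin2 t; move: (cos t) (sin t) => c s cs.
have -> : c ^+ 2 *+ 2 - 1 = c ^+ 2 - s ^+ 2 by rewrite -cs; ring.
have -> : r ^+ 2 + p.1 ^+ 2 + p.2 ^+ 2 =
  (r ^+ 2 + p.1 ^+ 2 + p.2 ^+ 2) * (c ^+ 2 + s ^+ 2) by rewrite cs mulr1.
ring.
Qed.

(** If [a] is half the polar angle of [(- p.1, p.2)], the velocity at time [t]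
    is [r] times the normalized velocity at time [t + a]. *)
Lemma perimeterE r p : 0 < r ->
  perimeter r p = r * h (Num.sqrt (p.1 ^+ 2 + p.2 ^+ 2) / r).
Proof.
move=> r0; have [a /andP[a0 api]] := polar_coordinates (- p.1) p.2.
rewrite sqrrN; set d := Num.sqrt _ => -[xd yd].
have d2 : d ^+ 2 = p.1 ^+ 2 + p.2 ^+ 2.
  by rewrite sqr_sqrtr// addr_ge0 ?sqr_ge0.
have pi0 := @pi_ge0 R.
rewrite hE ?divr_ge0 ?sqrtr_ge0 ?(ltW r0)// -speed_quarters.
rewrite -(@Rintegral_periodic _ _ _ a); last 3 first.
- exact: continuous_speed.
- move=> t; have -> : t + 2 * pi = t + pi + pi by ring.
  by rewrite !speedDpi.
- by lra.
rewrite -RintegralZl//; last first.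
  apply: continuous_integrable => t.
  apply: (@continuous_comp _ _ _ (fun t => t + a) (speed (d / r))).
    by apply: cvgD; [exact: cvg_id|exact: cvg_cst].
  exact: continuous_speed.
apply: eq_Rintegral => t _; rewrite elliptic_motion_velocity.
rewrite -{3}(ger0_norm (ltW r0)) -sqrtr_sqr /speed -sqrtrM ?sqr_ge0//.
congr Num.sqrt; rewrite mulrnDl (cosD (t *+ 2)).
have -> : r ^+ 2 + p.1 ^+ 2 + p.2 ^+ 2 = r ^+ 2 + d ^+ 2 by rewrite d2 addrA.
have -> : p.1 = - (d * cos (a *+ 2)) by rewrite -xd opprK.
rewrite {1}yd.
by field; rewrite gt_eqF.
Qed.

Lemma perimeter_le_disk r w p : 0 < r -> 0 <= w ->
  (perimeter r p <= r * h w) <-> disk (r * w) p.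
Proof.
move=> r0 w0; rewrite perimeterE// ler_pM2l// h_le_mono//; last first.
  by rewrite divr_ge0 ?sqrtr_ge0 ?(ltW r0).
rewrite ler_pdivrMr// (mulrC w) /disk /=.
rewrite -(@ler_pXn2r _ 2) ?nnegrE ?sqrtr_ge0 ?mulr_ge0 ?(ltW r0)//.
by rewrite sqr_sqrtr ?addr_ge0 ?sqr_ge0.
Qed.

End perimeter.

(** * Areas of concentric disks *)

(** The square root of a negative number is 0, so this is the length of the
    section of the disk of radius [s] at every abscissa [x]. *)
Definition chord (R : realType) (s x : R) : R :=
  2 * Num.sqrt (s ^+ 2 - x ^+ 2).

Section area.
Context {R : realType}.
Notation mu := (@lebesgue_measure R).
Notation area := (mu \x mu)%E.
Implicit Types s : R.

Lemma measurable_disk s : measurable (disk s : set (R * R)).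
Proof.
have mf : measurable_fun setT (fun p : R * R => p.1 ^+ 2 + p.2 ^+ 2).
  by apply: measurable_funD; apply: measurable_funX.
have := mf measurableT _ (measurable_itv `]-oo, s ^+ 2]).
by rewrite setTI.
Qed.

Lemma xsection_disk s x :
  mu (xsection (disk s) x) = (chord s x)%:E.
Proof.
rewrite /chord; have [sx|sx] := leP (x ^+ 2) (s ^+ 2); last first.
  rewrite ler0_sqrtr ?mulr0; last by lra.
  rewrite (_ : xsection _ _ = set0) ?measure0//.
  rewrite -subset0 => y; rewrite /xsection /= inE /disk /=.
  by have := sqr_ge0 y; lra.
set q := Num.sqrt _.
have q0 : 0 <= q by exact: sqrtr_ge0.
have q2 : q ^+ 2 = s ^+ 2 - x ^+ 2 by rewrite sqr_sqrtr// subr_ge0.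
rewrite (_ : xsection _ _ = `[- q, q]%classic).
  rewrite lebesgue_measure_itv /= lte_fin.
  case: ifPn => [_|]; first by rewrite -EFinD; congr (_%:E); lra.
  by rewrite -leNgt => ?; congr (_%:E); lra.
apply/seteqP; split => y;
  rewrite /xsection /= inE /disk /= in_itv /= -ler_norml.
  move=> H; rewrite -(@ler_pXn2r _ 2) ?nnegrE// real_normK ?num_real//; lra.
rewrite -(@ler_pXn2r _ 2) ?nnegrE// real_normK ?num_real//; lra.
Qed.

Lemma continuous_chord s : continuous (chord s).
Proof.
move=> x; apply: cvgM; first exact: cvg_cst.
apply: continuous_comp; last exact: sqrt_continuous.
apply: cvgB; first exact: cvg_cst.
exact: exprn_continuous.
Qed.

Lemma area_disk_chord s : 0 <= s ->
  area (disk s) = (\int[mu]_(x in `[- s, s]) chord s x)%:E.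
Proof.
move=> s0; rewrite /product_measure1.
have ic := continuous_integrable (- s) s (@continuous_chord s).
rewrite /Rintegral fineK; last exact: integrable_fin_num.
rewrite integral_mkcond; apply: eq_integral => x _ /=.
rewrite xsection_disk patchE; case: ifPn => // xs.
rewrite /chord ler0_sqrtr ?mulr0// subr_le0.
have : s < `|x|.
  rewrite ltNge ler_norml; apply: contra xs.
  by rewrite inE /= in_itv.
by rewrite -(@ltr_pXn2r _ 2) ?nnegrE// real_normK ?num_real// => /ltW.
Qed.

(** Each chord of the disk of radius [s] is [s] times a chord of the unit disk;
    the substitution in the slicing variable gives the second factor [s]. *)
Lemma area_disk s : 0 <= s ->
  area (disk s) = (s ^+ 2 * \int[mu]_(x in `[- 1, 1]) chord 1 x)%:E.
Proof.
rewrite le_eqVlt => /predU1P[<-|s0].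
  rewrite area_disk_chord// oppr0 set_itv1 Rintegral_set1.
  by rewrite expr0n /= mul0r.
rewrite area_disk_chord ?ltW//.
have := @Rintegral_affine R (chord s) (- 1) 1 0 s (@continuous_chord s) s0.
rewrite mulrN1 mulr1 !addr0 => ->; last by lra.
rewrite expr2 -mulrA -[in RHS]RintegralZl//; last first.
  exact: continuous_integrable (@continuous_chord 1).
congr ((_ * _)%:E); apply: eq_Rintegral => x _.
rewrite /chord addr0 mulrCA; congr (_ * _).
transitivity (Num.sqrt (s ^+ 2 * (1 ^+ 2 - x ^+ 2))).
  by congr Num.sqrt; ring.
by rewrite sqrtrM ?sqr_ge0// sqrtr_sqr gtr0_norm.
Qed.

Lemma unit_disk_area_gt0 : 0 < \int[mu]_(x in `[- 1, 1]) chord 1 x.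
Proof.
apply: Rintegral_gt0; [exact: continuous_chord|lra|].
move=> x /andP[x1 x2]; rewrite /chord mulr_gt0// sqrtr_gt0 expr1n.
have -> : 1 - x ^+ 2 = (1 - x) * (1 + x) by ring.
by rewrite mulr_gt0//; lra.
Qed.

Lemma disk_subset s s' : 0 <= s -> s <= s' -> disk s `<=` disk s'.
Proof.
move=> s0 ss' p; rewrite /disk /= => /le_trans; apply.
by rewrite ler_pXn2r ?nnegrE// (le_trans s0).
Qed.

Lemma uniform_disk_disk (rad s : R) : 0 < rad -> 0 <= s <= rad ->
  uniform_disk rad (disk s) = (s ^+ 2 / rad ^+ 2)%:E.
Proof.
move=> r0 /andP[s0 sr]; rewrite /uniform_disk gt_eqF//.
rewrite (setIidl (disk_subset s0 sr)) (area_disk s0) (area_disk (ltW r0)).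
have c0 := unit_disk_area_gt0.
rewrite inver gt_eqF ?mulr_gt0 ?exprn_gt0// -EFinM; congr (_%:E).
by field; rewrite !gt_eqF.
Qed.

Lemma uniform_disk_full (rad : R) (A : set (R * R)) :
  0 <= rad -> disk rad `<=` A -> uniform_disk rad A = 1%E.
Proof.
rewrite le_eqVlt => /predU1P[<-|r0] sA.
  rewrite /uniform_disk eqxx diracE mem_set//; apply: sA.
  by rewrite /disk /= expr0n /= addr0.
have rn0 : rad == 0 = false by rewrite gt_eqF.
have r20 : rad ^+ 2 != 0 by rewrite sqrf_eq0 rn0.
have rr : 0 <= rad <= rad by rewrite lexx ltW.
have := uniform_disk_disk r0 rr; rewrite (divff r20) => <-.
by rewrite /uniform_disk rn0 setIid (setIidr sA).
Qed.

End area.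

(** * The distribution function of the perimeter *)

Theorem mainTheorem4 (R : realType) (r rad : R) (hr : 0 < r) (hrad : 0 <= rad)
    (d : measure_display) (Omega : measurableType d) (Pr : probability Omega R)
    (P : {RV Pr >-> (R * R)%type})
    (hP : forall A : set (R * R),
       measurable A -> distribution Pr P A = uniform_disk rad A) :
  let kappa := rad / r in
  let U (omega : Omega) := perimeter r (P omega) in
  let G (u : R) := Pr [set omega | U omega <= u] in
  forall u : R,
    [/\ u < 2 * pi * r -> G u = 0%E,
        2 * pi * r <= u < r * h kappa ->
          (exists! w : R, 0 <= w /\ r * h w = u) /\
          (forall w : R, 0 <= w -> r * h w = u ->
             G u = (w ^+ 2 / kappa ^+ 2)%:E) &
        r * h kappa <= u -> G u = 1%E].
Proof.
move=> kappa U G u.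
have k0 : 0 <= kappa by rewrite divr_ge0 ?(ltW hr).
have rk : r * kappa = rad by rewrite /kappa mulrC divfK ?gt_eqF.
have Ulow omega : 2 * pi * r <= U omega.
  have v0 : 0 <= Num.sqrt ((P omega).1 ^+ 2 + (P omega).2 ^+ 2) / r.
    by rewrite divr_ge0 ?sqrtr_ge0 ?(ltW hr).
  by rewrite /U perimeterE// (mulrC _ r) ler_pM2l// -h0E h_le_mono.
have Gdisk w : 0 <= w -> r * h w = u -> G u = uniform_disk rad (disk (r * w)).
  move=> w0 <-; rewrite -hP; last exact: measurable_disk.
  rewrite /distribution /pushforward /G; congr (Pr _).
  by apply/seteqP; split => omega /=;
    rewrite /U => /(perimeter_le_disk _ hr w0).
split.
- move=> ulow; rewrite /G (_ : [set _ | _] = set0) ?measure0//.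
  rewrite -subset0 => omega /= /(le_trans (Ulow omega)).
  by rewrite leNgt ulow.
- move=> /andP[ulow uhigh].
  have [w /andP[w0 wk] rw] : exists2 w, 0 <= w <= kappa & h w = u / r.
    apply: h_IVT; first by rewrite lexx.
    by rewrite h0E ler_pdivlMr// ulow ler_pdivrMr// mulrC ltW.
  have hw : r * h w = u by rewrite rw mulrC divfK ?gt_eqF.
  have huniq w' : 0 <= w' -> r * h w' = u -> w' = w.
    move=> w'0; rewrite -hw => /(mulfI (lt0r_neq0 hr)) e.
    apply/eqP; rewrite eq_le.
    by rewrite -(h_le_mono w'0 w0) -(h_le_mono w0 w'0) e lexx.
  split; first by exists w; split => [//|w' [w'0 /(huniq _ w'0)]].
  move=> w' w'0 hw'; rewrite (Gdisk _ w'0 hw') (huniq _ w'0 hw').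
  have k_gt0 : 0 < kappa.
    rewrite lt_neqAle k0 andbT; apply/eqP => k0'.
    by move: uhigh; rewrite -k0' h0E mulrC ltNge ulow.
  rewrite uniform_disk_disk; last 2 first.
  + by rewrite -rk mulr_gt0.
  + by rewrite mulr_ge0 ?(ltW hr)//= -rk ler_pM2l.
  by rewrite -rk; congr (_%:E); field; rewrite !gt_eqF.
- move=> uhigh.
  (* If u is not a value of r h, then by the intermediate value theorem r h
     stays below u beyond kappa, and every perimeter is at most u. *)
  have [[w w0 hw]|nw] := pselect (exists2 w, 0 <= w & r * h w = u).
    rewrite (Gdisk _ w0 hw); apply: uniform_disk_full => //.
    apply: disk_subset => //; rewrite -rk ler_pM2l//.
    by rewrite -h_le_mono// -(ler_pM2l hr) hw.
  rewrite /G (_ : [set _ | _] = setT) ?probability_setT//.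
  apply/seteqP; split => // omega _ /=; rewrite leNgt; apply/negP => uU.
  apply: nw; rewrite /U perimeterE// in uU.
  set v := _ / r in uU.
  have v0 : 0 <= v by rewrite divr_ge0 ?sqrtr_ge0 ?(ltW hr).
  have huv : u / r <= h v by rewrite ler_pdivrMr// mulrC ltW.
  have hku : h kappa <= u / r by rewrite ler_pdivlMr// mulrC.
  have kv : kappa <= v by rewrite -h_le_mono// (le_trans hku).
  have [||w /andP[kw _] hw] := @h_IVT _ kappa v (u / r).
  + by rewrite k0.
  + by rewrite hku.
  exists w; first exact: le_trans kw.
  by rewrite hw mulrC divfK ?gt_eqF.
Qed.
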